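(* Let $(X,\widehat X,\widetilde X)$ be a metrizable compactification pack, let $\mathcal E_0$ be the $C_0$ coarse structure over $\widehat X$ attached to it, and let $\gamma$ be a uniform cover of $(\widehat X,\mathcal E_0)$. Then there exists an open, locally finite and uniform cover $\alpha$ of $\widehat X$ (i.e. a canonical cover) such that $\gamma\prec\alpha$ and $\operatorname{mult}\alpha\le\dim X+2$. Moreover, given a sequence $\{W_i\}_{i=0}^\infty$ of open subsets of $\widetilde X$ with $W_0=\widetilde X$, $W_0\supset\overline W_1\supset W_1\supset\overline W_2\supset W_2\supset\cdots$ and $\bigcap_{i=0}^\infty W_i=X$, such an $\alpha$ can be constructed in the form $$\alpha=\{U\cap(W_{i_k}\setminus\overline W_{i_{k+2}}):U\in\beta_k,\ k\ge0\},$$ where $\{\beta_k\}_{k=0}^\infty$ is a sequence of finite families of open subsets of $\widetilde X$ such that $\beta_0=\{\widetilde X\}$, $X\subset\bigcup_{V\in\beta_i}V$ for every $i$, and $\lim_{i,j\to\infty}\operatorname{mesh}\{V\cap W_j:V\in\beta_i\}=0$, and $\{i_k\}_{k=0}^\infty$ is a strictly increasing sequence of nonnegative integers with $i_0=0$.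
   Context: A metrizable compactification pack is a triple $(X,\widehat X,\widetilde X)$ where $\widetilde X$ is a metrizable compact space, $X$ is a nowhere dense closed subset of $\widetilde X$, and $\widehat X=\widetilde X\setminus X$. Fix a metric $d$ on $\widetilde X$ inducing its topology; $\operatorname{mesh}\beta=\sup\{\operatorname{diam}U:U\in\beta\}$. The $C_0$ coarse structure $\mathcal E_0$ over $\widehat X$ is the collection of all $E\subset\widehat X\times\widehat X$ such that for every $\varepsilon>0$ there is a compact $K\subset\widehat X$ with $d(x,y)<\varepsilon$ whenever $(x,y)\in E\setminus(K\times K)$ (independent of the metric). A cover of $\widehat X$ is a collection of subsets with union $\widehat X$; it is uniform if $\bigcup_{U\in\alpha}U\times U\in\mathcal E_0$. $\gamma\prec\alpha$ means each element of $\gamma$ is contained in some element of $\alpha$. $\operatorname{mult}\alpha=\sup\{\#A:A\subset\alpha,\ \bigcap_{U\in A}U\ne\varnothing\}$. A canonical cover is an open and locally finite cover $\alpha$ of $\widehat X$ such that for every $x\in X$ and every neighborhood $V_x$ of $x$ in $\widetilde X$ there is a neighborhood $W_x$ of $x$ in $\widetilde X$ with $\bigcup\{U\in\alpha:U\cap W_x\neq\varnothing\}\subset V_x$. $\dim$ is covering dimension (possibly $\infty$, in which case the bound on multiplicity is vacuous). *)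

(* Defs.v *)
(* MathComp-Analysis *)
From HB Require Import structures.
From mathcomp Require Import all_boot all_order all_algebra.
From mathcomp Require Import all_classical all_reals all_analysis.

Set Implicit Arguments.
Unset Strict Implicit.
Unset Printing Implicit Defensive.

Import Order.TTheory GRing.Theory Num.Theory.

Local Open Scope classical_set_scope.
Local Open Scope ring_scope.

(** Supremum in [0, +oo], so that the supremum of the empty set is 0. *)
Definition sup_nneg (R : realType) (S : set (\bar R)) : \bar R :=
  ereal_sup (0%E |` S).

Definition diam (R : realType) (T : metricType R) (U : set T) : \bar R :=
  sup_nneg [set (mdist p.1 p.2)%:E | p in U `*` U].

Definition mesh (R : realType) (T : metricType R) (beta : set (set T)) :
  \bar R := sup_nneg [set diam U | U in beta].

(** Families of sets are sets of sets: equal members count once. *)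
Definition mult (R : realType) (T : Type) (alpha : set (set T)) : \bar R :=
  sup_nneg [set @counting _ R A | A in
    [set A | A `<=` alpha /\ \bigcap_(U in A) U !=set0]].

Definition is_cover (T : Type) (Y : set T) (alpha : set (set T)) : Prop :=
  \bigcup_(U in alpha) U = Y.

Definition refines (T : Type) (gamma alpha : set (set T)) : Prop :=
  forall U, gamma U -> exists2 V, alpha V & U `<=` V.

Definition finite_open_cover (S : topologicalType) (alpha : set (set S)) :
    Prop :=
  [/\ finite_set alpha, alpha `<=` open & is_cover setT alpha].

(** Covering dimension, as an extended real: the infimum of the integers
    n - 1 >= -1 such that every finite open cover has a finite open refinement
    of multiplicity at most n. It is +oo if there is no such n, and -1 exactly
    when the space is empty. *)
Definition covering_dim (R : realType) (S : topologicalType) : \bar R :=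
  ereal_inf [set (n%:R - 1)%:E | n in [set n : nat |
    forall alpha : set (set S), finite_open_cover alpha ->
      exists beta : set (set S), [/\ finite_open_cover beta,
        refines beta alpha & (mult R beta <= n%:R%:E)%E]]].

(** Xtilde is the whole type T, with a fixed metric inducing its topology,
    and Xhat is the complement of X. *)
Definition compactification_pack (R : realType) (T : metricType R)
    (X : set T) : Prop :=
  [/\ compact [set: T], closed X & (closure X)^° = set0].

Definition C0_coarse (R : realType) (T : metricType R) (X : set T) :
    set (set (T * T)) :=
  [set E | E `<=` ~` X `*` ~` X /\
    forall e : R, 0 < e -> exists K : set T,
      [/\ compact K, K `<=` ~` X &
        forall x y, (E `\` (K `*` K)) (x, y) -> mdist x y < e]].

Definition uniform_cover (R : realType) (T : metricType R) (X : set T)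
    (alpha : set (set T)) : Prop :=
  is_cover (~` X) alpha /\ C0_coarse X (\bigcup_(U in alpha) (U `*` U)).

(** As X is closed, openness and neighbourhoods in Xhat may be taken in T. *)
Definition locally_finite_on (T : topologicalType) (Y : set T)
    (alpha : set (set T)) : Prop :=
  forall x, Y x -> exists2 V : set T, nbhs x V &
    finite_set [set U | alpha U /\ U `&` V !=set0].

Definition open_locally_finite_cover (T : topologicalType) (X : set T)
    (alpha : set (set T)) : Prop :=
  [/\ is_cover (~` X) alpha, alpha `<=` open &
      locally_finite_on (~` X) alpha].

Definition canonical_cover (T : topologicalType) (X : set T)
    (alpha : set (set T)) : Prop :=
  open_locally_finite_cover X alpha /\
  forall x, X x -> forall V : set T, nbhs x V ->
    exists2 W : set T, nbhs x W &
      \bigcup_(U in [set U | alpha U /\ U `&` W !=set0]) U `<=` V.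

Definition layered_family (T : topologicalType) (W : nat -> set T)
    (beta : nat -> set (set T)) (i : nat -> nat) : set (set T) :=
  [set A | exists k : nat, exists2 U, beta k U &
    A = U `&` (W (i k) `\` closure (W (i k.+2)))].

(* Main.v *)
Require Import Defs.
From mathcomp Require Import all_boot all_order all_algebra.
From mathcomp Require Import finmap.
From mathcomp Require Import all_classical all_reals all_analysis.
From mathcomp Require Import zify lra.

(** Write n for [dim X]. The bound n + 2 is the whole difficulty: consecutive
    layers of a layered family overlap, and superposing two unrelated covers of
    X of order n + 1 would only give 2 (n + 1).

    The way out is to pass from one cover to the next one element at a time.
    Choose finite families V_0, V_1, ... of open sets of the whole space that
    cover X, with meshes tending to 0, each refining the previous one by a map
    p and each of order at most n + 1 ([fine_cover_sequence]). Going from V_k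
    to V_k+1 down a collar of X, switch the elements u of V_k+1 on at distinct
    depths l(u). Above the depth l(u) the set u is a part of the old element
    p(u); below that depth it is an element of its own. The two roles coexist
    only in a thin slice at depth l(u), and those slices are disjoint. So a
    point lying in at most n + 1 members of V_k+1 lies in at most n + 2 members
    of the cover ([staircase_mult]). The pieces obtained are cut into layers by
    the definition of [staircase_piece]; the first layer consists of the single
    set T, which adds only one to the order of the next layer.

    Two more facts are needed. A cover of X of order at most n + 1 extends to
    open sets of T without increasing the order: replace b by the union of the
    balls B(y, r) with y in b and the trace of B(y, 2r) on X contained in b
    ([ball_extension_order]). And gamma becomes arbitrarily fine near X: for
    any family of open sets covering X, the members of gamma that come close
    enough to X lie each in a single set of the family
    ([uniform_cover_lebesgue]). Hence the depths can be taken along a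
    subsequence of W so sparse that each member of gamma meets at most two
    consecutive slices between depths and, if it lies below depth k + 1, is
    contained in a single member of V_k ([adapted_subsequence]); then it is
    contained in a single piece ([staircase_refine]).

    That the cover is open and locally finite is seen layer by layer, and it is
    uniform and canonical because the pieces get small in deep layers. *)

Set Implicit Arguments.
Unset Strict Implicit.
Unset Printing Implicit Defensive.

Import Order.TTheory GRing.Theory Num.Theory.
Local Open Scope classical_set_scope.
Local Open Scope ring_scope.

(** * Mesh, multiplicity and dimension *)

Lemma sup_nneg_le (R : realType) (S : set (\bar R)) (e : \bar R) :
  (0 <= e)%E -> (forall y, S y -> (y <= e)%E) -> (sup_nneg S <= e)%E.
Proof. by move=> e0 Se; apply: ge_ereal_sup => y [->//|/Se]. Qed.

Lemma sup_nneg_ge (R : realType) (S : set (\bar R)) (y : \bar R) :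
  S y -> (y <= sup_nneg S)%E.
Proof. by move=> Sy; apply: ereal_sup_ubound; right. Qed.

Lemma sup_nneg_ge0 (R : realType) (S : set (\bar R)) : (0 <= sup_nneg S)%E.
Proof. by apply: ereal_sup_ubound; left. Qed.

Lemma diam_le (R : realType) (T : metricType R) (U : set T) (e : R) :
  0 <= e -> (forall x y, U x -> U y -> mdist x y <= e) -> (diam U <= e%:E)%E.
Proof.
move=> e0 Ue; apply: sup_nneg_le; first by rewrite lee_fin.
by move=> _ [[x y] [/= Ux Uy]] <-; rewrite lee_fin Ue.
Qed.

Lemma mesh_le (R : realType) (T : metricType R) (b : set (set T)) (e : R) :
  0 <= e -> (forall U x y, b U -> U x -> U y -> mdist x y <= e) ->
  (mesh b <= e%:E)%E.
Proof.
move=> e0 be; apply: sup_nneg_le; first by rewrite lee_fin.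
by move=> _ [U bU] <-; apply: diam_le => // x y; apply: be.
Qed.

(** Bounding every finite subfamily suffices: an infinite family through a
    point has finite subfamilies of every size. *)
Lemma mult_leP (R : realType) (T : Type) (a : set (set T)) (N : nat) :
  (mult R a <= N%:R%:E)%E <->
  forall x (s : seq (set T)), uniq s -> (forall U, U \in s -> a U /\ U x) ->
    (size s <= N)%N.
Proof.
split=> [aN x s us sa|aN].
- have : (@counting _ R [set` s] <= N%:R%:E)%E.
    apply: le_trans aN; apply: sup_nneg_ge; exists [set` s] => //; split.
      by move=> U /sa[].
    by exists x => U /sa[].
  have fs : finite_set [set` s] by apply/finite_seqP; exists s.
  rewrite /counting asboolT//.
  rewrite lee_fin ler_nat; apply: leq_trans.
  by apply: uniq_leq_size => // U Us; rewrite in_fset_set//; apply/mem_set.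
- rewrite /mult; apply: sup_nneg_le; first by rewrite lee_fin.
  move=> _ [A [Aa [x Ax]] <-].
  have bnd (B : {fset set T}) : [set` B] `<=` A -> (#|` B| <= N)%N.
    move=> BA; apply: (aN x); first exact: fset_uniq.
    by move=> U UB; have AU := BA U UB; split; [exact: Aa|exact: Ax].
  rewrite /counting; case: asboolP => [fA|/(infinite_set_fset N.+1)[B BA]].
    by rewrite lee_fin ler_nat bnd// fset_setK.
  by rewrite ltnNge bnd.
Qed.

(** The list [L] may repeat sets and contain sets that miss [x], which spares
    deciding when two indices denote the same set. *)
Lemma mult_le_list (R : realType) (T : Type) (a : set (set T)) (N : nat) :
  (forall x, (exists2 A, a A & A x) -> exists2 L : seq (set T),
     (size L <= N)%N & forall A, a A -> A x -> A \in L) ->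
  (mult R a <= N%:R%:E)%E.
Proof.
move=> aL; apply/mult_leP => x [//|A s] us sa.
have [aA Ax] := sa A (mem_head _ _).
have [|L LN aLx] := aL x; first by exists A.
by apply: leq_trans LN; apply: uniq_leq_size => // B /sa[]; exact: aLx.
Qed.

(** The least such [N] is the covering dimension of [S] plus one. *)
Definition covers_of_order (R : realType) (S : topologicalType) (N : nat) :=
  forall a : set (set S), finite_open_cover a ->
    exists b : set (set S), [/\ finite_open_cover b, refines b a &
      (mult R b <= N%:R%:E)%E].

(** Stating the bound for all [N] at once covers infinite dimension, where the
    premise is void. *)
Lemma mult_le_dim (R : realType) (S : topologicalType) (T : Type)
    (a : set (set T)) :
  (forall N, covers_of_order R S N -> (mult R a <= N.+1%:R%:E)%E) ->
  (mult R a <= covering_dim R S + 2%:E)%E.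
Proof.
move=> H; rewrite -leeBlDr//; apply: le_ereal_inf_tmp => _ [N SN] <-.
rewrite leeBlDr// (le_trans (H N SN))// -EFinD lee_fin -natr1.
by rewrite -addrA lerD2l -natr1; lra.
Qed.

(** * Extending fine covers of X to the ambient space *)

(** Families are indexed, since the staircase below acts on indices; the sets
    [V v] with different indices are counted separately. *)
Definition order_le (T : Type) (V : nat -> set T) (N : nat) :=
  forall x (s : seq nat), uniq s -> (forall v, v \in s -> V v x) ->
    (size s <= N)%N.

Lemma seq_argmin (R : realType) (r : nat -> R) (s : seq nat) : s != [::] ->
  exists2 u, u \in s & forall v, v \in s -> r u <= r v.
Proof.
elim: s => // w s IH _; case: (eqVneq s [::]) => [->|/IH[u us um]].
  by exists w => [|v]; rewrite inE// => /eqP->.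
have [wu|uw] := leP (r w) (r u).
  exists w; first by rewrite mem_head.
  by move=> v; rewrite inE => /predU1P[->//|/um]; exact: le_trans.
exists u; first by rewrite inE us orbT.
by move=> v; rewrite inE => /predU1P[->|/um//]; exact: ltW.
Qed.

(** The trace condition uses twice the radius so that, of several overlapping
    balls, the centre of the smallest lies in the trace of all the others. *)
Definition ball_extension (R : realType) (T : metricType R) (X : set T)
    (b : set (set_type X)) : set T :=
  [set x | exists (y : set_type X) (r : R), [/\ 0 < r, mdist (set_val y) x < r &
     forall z : set_type X, mdist (set_val y) (set_val z) < r *+ 2 -> b z]].

Lemma ball_extension_open (R : realType) (T : metricType R) (X : set T)
    (b : set (set_type X)) : open (ball_extension b).
Proof.
rewrite openE => x [y [r [r0 yx yb]]]; rewrite /interior.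
have d0 : 0 < r - mdist (set_val y) x by rewrite subr_gt0.
apply: filterS (nbhsx_ballx x _ d0) => z; rewrite ballEmdist/= => xz.
exists y, r; split => //; rewrite (le_lt_trans (metric_triangle _ x _))//.
by rewrite -ltrBrDl.
Qed.

Lemma sub_ball_extension (R : realType) (T : metricType R) (X : set T)
    (b : set (set_type X)) : open b -> forall y, b y ->
  ball_extension b (set_val y).
Proof.
move=> [B oB <-] y /= By.
have /nbhs_ballP[e /= e0 eB] : nbhs (set_val y) B by apply: open_nbhs_nbhs.
exists y, (e / 2); split; [exact: divr_gt0|by rewrite mdistxx divr_gt0|].
by move=> z; rewrite mulr2n -splitr => yz; apply: eB; rewrite ballEmdist.
Qed.

(** If [x] lies in balls [B(y_v, r_v)] and [r_u] is the smallest radius, then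
    [d(y_v, y_u) < r_v + r_u <= 2 r_v] for each [v], so [y_u] lies in each
    [b v]. *)
Lemma ball_extension_order (R : realType) (T : metricType R) (X : set T)
    (b : nat -> set (set_type X)) (N : nat) :
  order_le b N -> order_le (fun v => ball_extension (b v)) N.
Proof.
move=> bN x s us sx; case: (eqVneq s [::]) => [->//|s0].
(* [X] may be empty, hence the option. *)
have /choice[y /choice[r yr]] : forall v, exists (y : option (set_type X)),
    exists r : R, v \in s -> exists2 y', y = Some y' &
    [/\ 0 < r, mdist (set_val y') x < r &
      forall z : set_type X, mdist (set_val y') (set_val z) < r *+ 2 -> b v z].
  move=> v; case: (boolP (v \in s)) => [/sx[y [r H]]|_].
    by exists (Some y), r => _; exists y.
  by exists None, 0.
have [u us' um] := seq_argmin r s0.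
have [y0 _ [_ y0x _]] := yr u us'.
apply: (bN y0 s us) => v vs; have [y1 _ [_ y1x]] := yr v vs; apply.
rewrite (le_lt_trans (metric_triangle _ x _))// mulr2n ltrD//.
by rewrite metric_sym (lt_le_trans y0x)// um.
Qed.

(** This is the near covering property for the filter generated by the sets of
    subfamilies that contain a given finite subfamily of [O]. *)
Lemma compact_finite_subcover (T : topologicalType) (X : set T)
    (O : set (set T)) : compact X -> O `<=` open -> X `<=` \bigcup_(Q in O) Q ->
  exists D, [/\ finite_set D, D `<=` O & X `<=` \bigcup_(Q in D) Q].
Proof.
move=> /compact_near_coveringP cX Oo XO.
pose F : set_system (set (set T)) :=
  filter_from [set D | finite_set D /\ D `<=` O] (fun D => [set E | D `<=` E]).
have FF : Filter F.
  apply: filter_from_filter; first by exists set0; split=> //; exact: sub0set.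
  move=> D E [fD DO] [fE EO]; exists (D `|` E).
    by split; [rewrite finite_setU|rewrite subUset].
  move=> G /= DEG; split; apply: subset_trans DEG.
    exact: subsetUl.
  exact: subsetUr.
have [x Xx|D [fD DO] XD] := cX _ F (fun D x => exists2 Q, D Q & Q x) FF.
  have [Q OQ Qx] := XO _ Xx; exists (Q, [set D : set (set T) | D Q]).
    split=> /=; first by apply: open_nbhs_nbhs; split => //; exact: Oo.
    exists [set Q] => [|D]; last by apply.
    by split; [exact: finite_set1|move=> _ ->].
  by move=> [y D] [/= Qy DQ]; exists Q.
by exists D; split => //; exact: XD.
Qed.

(** One cover serves all [N]: it comes from the smallest admissible [N] if there
    is one, and is a mere finite subcover otherwise. *)
Lemma fine_open_cover (R : realType) (T : metricType R) (X : set T)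
    (O : set (set T)) : compact X -> O `<=` open -> X `<=` \bigcup_(Q in O) Q ->
  exists (V : nat -> set T) (m : nat), [/\
    forall v, open (V v) /\ ((m <= v)%N -> V v = set0),
    X `<=` \bigcup_v V v,
    forall v, V v !=set0 -> exists2 Q, O Q & V v `<=` Q &
    forall N, covers_of_order R (set_type X) N -> order_le V N].
Proof.
move=> cX Oo XO.
have [D [fD DO XD]] := compact_finite_subcover cX Oo XO.
pose a0 : set (set (set_type X)) := [set set_val @^-1` Q | Q in D].
have a0cov : finite_open_cover a0.
  split.
  - exact: finite_image.
  - by move=> _ [Q /DO/Oo oQ] <-; exists Q.
  - apply/seteqP; split => // y _.
    have [Q DQ Qy] := XD _ (set_valP y).
    by exists (set_val @^-1` Q) => //; exists Q.
have [b [bfin bo bcov] [ba bN]] : exists2 b, finite_open_cover b &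
    refines b a0 /\ forall N, covers_of_order R (set_type X) N ->
       (mult R b <= N%:R%:E)%E.
  have [exN|nexN] :=
    pselect (exists N, `[< covers_of_order R (set_type X) N >]).
    case: (ex_minnP exN) => N /asboolP NX Nmin.
    have [b [bcov ba bN]] := NX _ a0cov; exists b => //.
    split => // M /asboolP MX.
    by rewrite (le_trans bN)// lee_fin ler_nat Nmin.
  exists a0 => //; split; first by move=> U; exists U.
  by move=> N NX; case: nexN; exists N; apply/asboolP.
move: bfin => /finite_seqP[s0 bs0]; set s := undup s0.
have us : uniq s := undup_uniq s0.
have sb c : (c \in s) <-> b c by rewrite mem_undup bs0.
have subD c : b c -> exists Q, [/\ D Q, O Q & forall y, c y -> Q (set_val y)].
  by move=> /ba[_ [Q DQ <-] cQ]; exists Q; split => //; exact: DO.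
have /choice[f fP] : forall c, exists Q : set T, b c ->
    O Q /\ forall y, c y -> Q (set_val y).
  move=> c; have [/subD[Q [? ? ?]]|] := pselect (b c); first by exists Q.
  by exists set0.
(* The default [set0] confines the indices of sets through a point to the
   first [size s]. *)
pose B v := nth set0 s v.
have sB v : (v < size s)%N -> b (B v) by move=> vs; apply/sb/mem_nth.
have BN N : covers_of_order R (set_type X) N -> order_le B N.
  move=> NX y t ut ty; have /mult_leP := bN N NX => /(_ y (map B t)).
  have ts v : v \in t -> (v < size s)%N.
    by move=> /ty; rewrite /B; case: ltnP => // sv; rewrite nth_default.
  rewrite size_map; apply.
    rewrite map_inj_in_uniq// => v w /ts vs /ts ws /eqP.
    by rewrite /B nth_uniq// => /eqP.
  by move=> _ /mapP[v vt ->]; split; [exact/sB/ts|exact: ty].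
exists (fun v =>
  if (v < size s)%N then ball_extension (B v) `&` f (B v) else set0), (size s).
split.
- move=> v; case: ltnP => vs; last by split => //; exact: open0.
  split=> //; apply: openI; first exact: ball_extension_open.
  by apply: Oo; have [] := fP _ (sB v vs).
- move=> x Xx; have : setT (exist _ x (mem_set Xx) : set_type X) by [].
  rewrite -bcov => -[c bc cx]; exists (index c s) => //.
  have cs : c \in s by apply/sb.
  rewrite index_mem cs /B nth_index//; split.
    exact: (sub_ball_extension (bo _ bc) cx).
  by have [_ /(_ _ cx)] := fP _ bc.
- move=> v [x]; case: ltnP => // vs _; exists (f (B v)); last by move=> ? [].
  by have [] := fP _ (sB v vs).
- move=> N /BN/ball_extension_order H x t ut tx; apply: (H x t ut) => v /tx.
  by case: ifP => // _ [].
Qed.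

(** Each family comes from [fine_open_cover], applied to the intersections of
    small balls with the members of the previous family, or with the whole space
    at the first step. *)
Lemma fine_cover_sequence (R : realType) (T : metricType R) (X : set T) :
  compact X ->
  exists (V : nat -> nat -> set T) (m : nat -> nat), [/\
    forall k v, open (V k v) /\ ((m k <= v)%N -> V k v = set0),
    forall k, X `<=` \bigcup_v V k v,
    forall k v, exists u, V k.+1 v `<=` V k u,
    forall k v x y, V k v x -> V k v y -> mdist x y <= k.+2%:R^-1 &
    forall k N, covers_of_order R (set_type X) N -> order_le (V k) N].
Proof.
move=> cX.
have /choice[f fP] : forall kF : nat * (nat -> set T),
    exists Vm : (nat -> set T) * nat,
    (forall v, open (kF.2 v)) -> X `<=` \bigcup_v kF.2 v -> [/\
      forall v, open (Vm.1 v) /\ ((Vm.2 <= v)%N -> Vm.1 v = set0),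
      X `<=` \bigcup_v Vm.1 v,
      forall v, exists u, Vm.1 v `<=` kF.2 u,
      forall v x y, Vm.1 v x -> Vm.1 v y -> mdist x y <= kF.1.+2%:R^-1 &
      forall N, covers_of_order R (set_type X) N -> order_le Vm.1 N].
  move=> [k F] /=.
  have [[oF XF]|nF] := pselect ((forall v, open (F v)) /\ X `<=` \bigcup_v F v);
    last by exists (F, 0%N) => ? ?; case: nF.
  pose r : R := k.+2%:R^-1 / 2.
  have r0 : 0 < r by rewrite divr_gt0// invr_gt0.
  have [|x Xx|V [m [oV XV VF VN]]] := @fine_open_cover _ _ X
    [set F p.1 `&` (ball p.2 r)° | p in [set: nat * T]] cX.
  - by move=> _ [[v x] _ <-] /=; apply: openI => //; exact: open_interior.
  - have [v _ Fx] := XF _ Xx.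
    exists (F v `&` (ball x r)°); first by exists (v, x).
    by split => //; exact: nbhsx_ballx.
  exists (V, m) => _ _; split => //= v.
    have [->|/set0P/VF[_ [[u x] _ <-] /= Vu]] := eqVneq (V v) set0.
      by exists 0%N.
    by exists u; apply: subset_trans Vu _; exact: subIsetl.
  move=> x y Vx Vy; have /VF[_ [[u z] _ <-] /= Vu] : V v !=set0 by exists x.
  have /interior_subset zx := (Vu _ Vx).2.
  have /interior_subset zy := (Vu _ Vy).2.
  have := ball_triangle (ball_sym zx) zy.
  by rewrite -splitr ballEmdist => /ltW.
pose S := fix S k :=
  if k is k'.+1 then f (k, (S k').1) else f (0%N, fun=> setT).
pose F k := if k is k'.+1 then (S k').1 else fun=> setT.
have SE k : S k = f (k, F k) by case: k.
have FP k : (forall v, open (F k v)) /\ X `<=` \bigcup_v F k v.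
  elim: k => [|k [IH1 IH2]].
    by split; [move=> v; exact: openT|move=> x _; exists 0%N].
  have [oV XV _ _ _] := fP (k, F k) IH1 IH2.
  have -> : F k.+1 = (f (k, F k)).1 by rewrite -SE.
  by split; [move=> w; have [] := oV w|exact: XV].
have SP k := fP (k, F k) (FP k).1 (FP k).2.
exists (fun k => (S k).1), (fun k => (S k).2); split.
- by move=> k v; rewrite SE; have [+ _ _ _ _] := SP k; apply.
- by move=> k; rewrite SE; have [_ + _ _ _] := SP k.
- by move=> k v; rewrite SE; have [_ _ + _ _] := SP k.+1; apply.
- by move=> k v; rewrite SE; have [_ _ _ + _] := SP k; apply.
- by move=> k N; rewrite SE; have [_ _ _ _ +] := SP k; apply.
Qed.

(** * Uniform covers near X *)

Lemma notin_bigcap (T : Type) (W : nat -> set T) (X : set T) (x : T) :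
  \bigcap_n W n = X -> ~ X x -> exists n, ~ W n x.
Proof.
move=> WX nXx; apply: contrapT => /forallNP H; apply: nXx.
by rewrite -WX => n _; exact: contrapT.
Qed.

Lemma closure_chain_decreasing (T : topologicalType) (W : nat -> set T) m n :
  (forall n, closure (W n.+1) `<=` W n) -> (m <= n)%N -> W n `<=` W m.
Proof.
move=> Wcl mn; rewrite -(subnK mn); elim: (n - m)%N => // k IH.
by rewrite addSn => x Wx; apply/IH/Wcl/subset_closure.
Qed.

(** By compactness it is enough to argue near each point [x] of [T]. Away from
    [X], a neighbourhood of [x] misses [W n] for large [n]. At [x] in [X], a
    compact subset of the complement of [X] misses a ball around [x], so
    uniformity makes the members of [gamma] that meet this ball small; those
    that meet a small enough ball lie in a given neighbourhood of [x]. *)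
Lemma uniform_cover_lebesgue (R : realType) (T : metricType R) (X : set T)
    (gamma : set (set T)) (W : nat -> set T) (O : nat -> set T) :
  compact [set: T] -> uniform_cover X gamma ->
  (forall n, closure (W n.+1) `<=` W n) -> \bigcap_n W n = X ->
  (forall v, open (O v)) -> X `<=` \bigcup_v O v ->
  exists n0, forall n, (n0 <= n)%N -> forall G, gamma G -> G `&` W n !=set0 ->
    exists v, G `<=` O v.
Proof.
move=> cT [gcov [gX gC0]] Wcl WX Oo XO.
have /compact_near_coveringP/(_ nat \oo
  (fun n x => forall G, gamma G -> G x -> W n x -> exists v, G `<=` O v)) := cT.
case=> [x _|n0 _ H]; last first.
  by exists n0 => n /H{}H G gG [x [Gx Wx]]; apply: (H x).
have [Xx|nXx] := pselect (X x).
- have [v _ Ovx] := XO _ Xx.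
  have /nbhs_ballP[e /= e0 eO] : nbhs x (O v) by exact: open_nbhs_nbhs.
  have e20 : 0 < e / 2 by rewrite divr_gt0.
  have [K [cK KX Ke]] := gC0 _ e20.
  have nK : nbhs x (~` K).
    apply: open_nbhs_nbhs; split; last by move=> /KX.
    by apply: closed_openC; apply: compact_closed cK; exact: metric_hausdorff.
  exists (ball x (e / 2) `&` ~` K, setT).
    split=> /=; last exact: filterT.
    by apply: filterI nK; exact: nbhsx_ballx.
  move=> [y n] [[/= xy nKy] _] G gG Gy _; exists v => z Gz; apply: eO.
  rewrite (splitr e); apply: ball_triangle xy _; rewrite ballEmdist/=.
  apply: Ke; split; first by exists G.
  by case.
- have [n nWx] := notin_bigcap WX nXx.
  have nWx1 : ~ closure (W n.+1) x by move=> /Wcl.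
  exists (~` closure (W n.+1), [set k | (n < k)%N]).
    split=> /=; last exact: nbhs_infty_gt.
    by apply: open_nbhs_nbhs; split => //; exact/closed_openC/closed_closure.
  move=> [y k] /= [nWy nk] G _ _ Wky; case: nWy; apply: subset_closure.
  exact: (closure_chain_decreasing Wcl nk).
Qed.

(** * Layered families with small deep pieces *)

Lemma strict_chain_le (i : nat -> nat) : (forall k, (i k < i k.+1)%N) ->
  forall j k, (j <= k)%N -> (i j <= i k)%N.
Proof.
move=> ii j k; have : {homo i : j k / (j <= k)%N}; last exact.
by apply: homo_leq => // [?|]; [exact: leq_trans|move=> n; exact: ltnW].
Qed.

Lemma strict_chain_ge (i : nat -> nat) : (forall k, (i k < i k.+1)%N) ->
  forall k, (k <= i k)%N.
Proof. by move=> ii; elim=> // k IH; exact: leq_ltn_trans IH (ii k). Qed.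

Section layered.
Context (R : realType) (T : metricType R) (X : set T) (W : nat -> set T).
Context (beta : nat -> set (set T)) (i : nat -> nat).
Hypothesis cT : compact [set: T].
Hypothesis oW : forall n, open (W n).
Hypothesis Wcl : forall n, closure (W n.+1) `<=` W n.
Hypothesis WX : \bigcap_n W n = X.
Hypothesis bfin : forall k, finite_set (beta k).
Hypothesis bo : forall k, beta k `<=` open.
Hypothesis ii : forall k, (i k < i k.+1)%N.
Let alpha := layered_family W beta i.
Hypothesis acov : ~` X `<=` \bigcup_(A in alpha) A.
Hypothesis small : forall e : R, 0 < e -> exists K, forall k U x y,
  (K <= k)%N -> beta k U -> U x -> U y -> mdist x y < e.

Let imono := strict_chain_le ii.

Lemma layered_sub A : alpha A -> A `<=` ~` X.
Proof.
move=> [k [U _ ->]] x [_ [_ nW]]; rewrite -WX => Wx.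
by apply/nW/subset_closure/Wx.
Qed.

Lemma layered_open_locally_finite : open_locally_finite_cover X alpha.
Proof.
split.
- by apply/seteqP; split => // x [A aA Ax]; exact: layered_sub aA x Ax.
- move=> _ [k [U bU ->]]; apply: openI; first exact: bo bU.
  by apply: openI => //; exact/closed_openC/closed_closure.
- move=> x nXx.
  have [n nWx] := notin_bigcap WX nXx.
  exists (~` closure (W n.+1)).
    apply: open_nbhs_nbhs; split; first exact/closed_openC/closed_closure.
    by move=> /Wcl.
  apply: (@sub_finite_set _ _ (\bigcup_(k in `I_n.+1)
     [set U `&` (W (i k) `\` closure (W (i k.+2))) | U in beta k])); last first.
    by apply: bigcup_finite => // k _; exact: finite_image.
  move=> A [[k [U bU AE]] [y [Ay nWy]]]; exists k => /=; last by exists U.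
  rewrite ltnNge; apply/negP => nk; apply: nWy; apply: subset_closure.
  move: Ay; rewrite AE => -[_ [+ _]]; apply: (closure_chain_decreasing Wcl).
  exact: leq_trans nk (strict_chain_ge ii k).
Qed.

(** A member of the family that meets [W (i K.+1)] cannot come from a layer
    before the [K]-th. *)
Lemma layered_small e : 0 < e -> exists n, forall A, alpha A ->
  A `&` W n !=set0 -> forall x y, A x -> A y -> mdist x y < e.
Proof.
move=> /small[K Ke]; exists (i K.+1) => A [k [U bU ->]] [z [[_ [_ nWz]] Wz]].
have kK : (K <= k)%N.
  rewrite leqNgt; apply/negP => kK; apply/nWz/subset_closure.
  by apply: (closure_chain_decreasing Wcl) Wz; exact: imono.
by move=> x y [Ux _] [Uy _]; exact: Ke bU Ux Uy.
Qed.

Lemma layered_uniform : uniform_cover X alpha.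
Proof.
have [acov' _ _] := layered_open_locally_finite; split => //; split.
  by move=> [x y] [A aA [/= Ax Ay]]; split; exact: layered_sub aA _ _.
move=> e /layered_small[n ne]; exists (~` W n); split.
- by apply: subclosed_compact cT _ => //; exact: open_closedC.
- by apply: subsetC; rewrite -WX => x; apply.
- move=> x y [[A aA [/= Ax Ay]] nK]; apply: (ne _ aA _ _ _ Ax Ay).
  apply: contrapT => /nonemptyPn An; apply: nK; split=> /= Wz.
    by have : (A `&` W n) x; [split|rewrite An => -[]].
  by have : (A `&` W n) y; [split|rewrite An => -[]].
Qed.

Lemma layered_canonical : canonical_cover X alpha.
Proof.
split; first exact: layered_open_locally_finite.
move=> x Xx V /nbhs_ballP[e /= e0 eV].
have e20 : 0 < e / 2 by rewrite divr_gt0.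
have [n ne] := layered_small e20; exists (ball x (e / 2) `&` W n).
  apply: filterI; first exact: nbhsx_ballx.
  by apply: open_nbhs_nbhs; split => //; move: Xx; rewrite -WX; apply.
move=> y [A [aA [z [Az [xz Wz]]]] Ay]; apply: eV; rewrite (splitr e).
apply: ball_triangle xz _; rewrite ballEmdist/=; apply: (ne _ aA _ _ _ Az Ay).
by exists z.
Qed.
End layered.

(** * The staircase between consecutive covers *)

Lemma last_before_failure (P : nat -> Prop) : P 0%N -> (exists n, ~ P n) ->
  exists s, P s /\ ~ P s.+1.
Proof.
move=> P0 [n nPn]; apply: contrapT => /forallNP H; apply: nPn.
by elim: n => // n IH; apply: contrapT => nP; exact: (H n).
Qed.

Section staircase.
Context (T : topologicalType) (X : set T) (w : nat -> set T).
Context (V : nat -> nat -> set T) (m : nat -> nat) (p : nat -> nat -> nat).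
Hypothesis w0 : w 0%N = setT.
Hypothesis wo : forall s, open (w s).
Hypothesis wcl : forall s, closure (w s.+1) `<=` w s.
Hypothesis wX : \bigcap_s w s = X.
Hypothesis Vo : forall k v, open (V k v).
Hypothesis Vm : forall k v x, V k v x -> (v < m k)%N.
Hypothesis VX : forall k, X `<=` \bigcup_v V k v.
Hypothesis Vp : forall k u, V k.+1 u `<=` V k (p k u).

(** Layer [j.+1] is made of the sets [V j v]. It reserves one depth for each of
    them to be switched on, and one more. *)
Fixpoint layer_start (k : nat) : nat :=
  if k is j.+1 then (layer_start j + (if j is h.+1 then m h else 0)).+1
  else 0%N.
Local Notation t := layer_start.

Definition switch k v := (t k.+1 + v).+1.
Local Notation l := switch.

(** The role of [V k v] in the cover: it is switched on at depth [switch k v];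
    it is used entirely until the next layer has begun; from then on it shrinks
    to the union of its subsets [V k.+1 u] not yet replaced by their own pieces.
    The shrinking lags one depth behind the switching, so that sets meeting at
    most two consecutive slices fit into one of the two roles. The term
    [w (t k.+3)], which lies below the layer of the piece, makes the pieces of
    each layer cover [X]. *)
Definition staircase_piece k v : set T := (V k v `&` w (l k v)) `&`
  (~` closure (w (t k.+2).+1) `|`
   \bigcup_(u in [set u | p k u = v])
     (V k.+1 u `\` closure (w (l k.+1 u).+1)) `|`
   w (t k.+3)).
Local Notation U := staircase_piece.

Definition staircase_family k : set (set T) :=
  if k is j.+1 then [set U j v | v in `I_(m j)] else [set setT].
Local Notation beta := staircase_family.
Local Notation alpha := (layered_family w beta t).

Lemma layer_start_lt k : (t k < t k.+1)%N.
Proof. by case: k => [|k] //=; rewrite ltnS leq_addr. Qed.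

Lemma switch_gt k v : (t k.+1 < l k v)%N.
Proof. by rewrite ltnS leq_addr. Qed.

Lemma switch_lt k v x : V k v x -> (l k v < t k.+2)%N.
Proof. by move=> /Vm vm; rewrite /switch /= ltnS ltn_add2l. Qed.

Let w_le j k : (j <= k)%N -> w k `<=` w j.
Proof. exact: closure_chain_decreasing. Qed.

Let X_w s : X `<=` w s.
Proof. by rewrite -wX => x; apply. Qed.

Lemma staircase_finite k : finite_set (beta k).
Proof. by case: k => [|k]; [exact: finite_set1|exact: finite_image]. Qed.

Lemma staircase_open k : beta k `<=` open.
Proof.
case: k => [_ ->|k _ [v _ <-]]; first exact: openT.
have oC s : open (~` closure (w s)) by exact/closed_openC/closed_closure.
apply: openI; first by apply: openI; [exact: Vo|exact: wo].
apply: openU => //; apply: openU => //.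
by apply: bigcup_open => u _; apply: openI; [exact: Vo|exact: oC].
Qed.

Lemma staircase_covers k : X `<=` \bigcup_(A in beta k) A.
Proof.
case: k => [|k] x Xx; first by exists setT.
have [v _ Vx] := VX k Xx; exists (U k v); first by exists v => //; exact: Vm Vx.
by split; [split => //; exact: X_w|right; exact: X_w].
Qed.

(** Let [s] be the last depth containing [G], in layer [j.+1], and let [V j v]
    contain [G]. If [V j v] is switched on by depth [s], its piece contains [G].
    Otherwise [G] avoids the depths where [V j v] has left the piece of its
    parent, so the parent's piece contains [G]. *)
Lemma staircase_refine (gamma : set (set T)) :
  gamma `<=` [set G | G `<=` ~` X] ->
  (forall s G, gamma G -> G `&` closure (w s.+1) !=set0 -> G `<=` w s) ->
  (forall k G, gamma G -> G !=set0 -> G `<=` w (t k.+1) ->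
    exists v, G `<=` V k v) ->
  refines gamma alpha.
Proof.
move=> gX gw gV G gG.
have [->|/set0P [x Gx]] := eqVneq G set0.
  exists (setT `&` (w (t 0%N) `\` closure (w (t 2)))) => //.
  by exists 0%N, setT.
have [s [Gs nGs]] : exists s, G `<=` w s /\ ~ G `<=` w s.+1.
  apply: last_before_failure; first by rewrite w0.
  apply: contrapT => /forallNP H; apply: (gX _ gG _ Gx).
  by rewrite -wX => n _; exact: (contrapT (H n) x Gx).
have Gcl r : (s.+2 <= r)%N -> G `<=` ~` closure (w r).
  move=> sr y Gy /(closureS (w_le sr)) wy; apply: nGs; apply: (gw _ _ gG).
  by exists y.
have [k [ks ksS]] : exists k, (t k <= s)%N /\ ~ (t k.+1 <= s)%N.
  apply: last_before_failure => //; exists s.+1; apply/negP; rewrite -ltnNge.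
  exact: (strict_chain_ge layer_start_lt).
have {ksS} sk : (s < t k.+1)%N by rewrite ltnNge; apply/negP.
have Gw r : (r <= s)%N -> G `<=` w r.
  by move=> rs; apply: subset_trans (w_le rs).
have tS j : (t j < t j.+1)%N := layer_start_lt j.
case: k ks sk => [|j] ks sk.
  exists (setT `&` (w (t 0%N) `\` closure (w (t 2)))).
    by exists 0%N, setT.
  move=> y Gy; do 2 split => //; first by rewrite w0.
  by apply: (Gcl _ _ _ Gy); exact: leq_ltn_trans sk (tS _).
have [v Gv] : exists v, G `<=` V j v.
  by apply: (gV _ _ gG); [exists x|exact: Gw].
have lt := switch_lt (Gv _ Gx).
have [ls|sl] := leqP (l j v) s.
  exists (U j v `&` (w (t j.+1) `\` closure (w (t j.+3)))).
    by exists j.+1, (U j v) => //; exists v => //; exact: Vm (Gv _ Gx).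
  move=> y Gy; split; [split|split].
  - by split; [exact: Gv|exact: (Gw _ ls y Gy)].
  - by left; left; apply: (Gcl _ _ _ Gy).
  - exact: (Gw _ ks y Gy).
  - by apply: (Gcl _ _ _ Gy); exact: leq_ltn_trans sk (tS _).
have st : (s.+2 <= t j.+2)%N by exact: leq_ltn_trans sl lt.
case: j => [|h] in ks sk v Gv lt sl st *.
  exists (setT `&` (w (t 0%N) `\` closure (w (t 2)))).
    by exists 0%N, setT.
  by move=> y Gy; do 2 split => //; [rewrite w0|exact: (Gcl _ _ _ Gy)].
have Ga : G `<=` V h (p h v) by move=> y /Gv; exact: Vp.
exists (U h (p h v) `&` (w (t h.+1) `\` closure (w (t h.+3)))).
  exists h.+1, (U h (p h v)) => //; exists (p h v) => //.
  exact: Vm (Ga _ Gx).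
move=> y Gy; split; [split|split].
- split; first exact: Ga.
  apply: (Gw _ _ _ Gy); apply: leq_trans ks.
  exact/ltnW/(switch_lt (Ga _ Gx)).
- by left; right; exists v => //; split; [exact: Gv|exact: (Gcl _ _ _ Gy)].
- by apply: (Gw _ _ _ Gy); apply: leq_trans ks; exact/ltnW/tS.
- exact: (Gcl _ _ _ Gy).
Qed.

(** Let [s] be the last depth containing [x], in layer [k]. Only the layers
    [k.-1] and [k] reach [x]. A set [V h.+1 u] through [x] accounts for the
    piece of its parent only if [s <= l h.+1 u], and for its own piece only if
    [l h.+1 u <= s]. The switching depths being distinct, at most one [u] is
    counted twice. *)
Lemma staircase_mult (R : realType) N : (forall k, order_le (V k) N) ->
  (mult R alpha <= N.+1%:R%:E)%E.
Proof.
move=> VN; apply: mult_le_list => x [A0 [k0 [U0 _ ->]] [_ [_ ncl0]]].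
pose A k v := U k v `&` (w (t k.+1) `\` closure (w (t k.+3))).
pose B := setT `&` (w (t 0%N) `\` closure (w (t 2))).
pose S k := [seq v <- iota 0 (m k) | `[< V k v x >]].
have inS k v : V k v x -> v \in S k.
  by move=> Vx; rewrite mem_filter mem_iota /= (Vm Vx) andbT; apply/asboolP.
have uS k : uniq (S k) by rewrite filter_uniq// iota_uniq.
have szS k : (size (S k) <= N)%N.
  by apply: (VN k x) => // v; rewrite mem_filter => /andP[/asboolP].
have [s [ws nws]] : exists s, w s x /\ ~ w s.+1 x.
  apply: last_before_failure; first by rewrite w0.
  by exists (t k0.+2) => H; exact/ncl0/subset_closure.
have w_s r : w r x -> (r <= s)%N.
  by move=> wr; rewrite leqNgt; apply/negP => sr; apply: nws; exact: w_le wr.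
have ncl_s r : ~ closure (w r) x -> (s < r)%N.
  move=> nr; rewrite ltnNge; apply/negP => rs; apply/nr/subset_closure.
  exact: w_le ws.
have [k [ks ksS]] : exists k, (t k <= s)%N /\ ~ (t k.+1 <= s)%N.
  apply: last_before_failure => //; exists s.+1; apply/negP; rewrite -ltnNge.
  exact: (strict_chain_ge layer_start_lt).
have {ksS} sk : (s < t k.+1)%N by rewrite ltnNge; apply/negP.
have tle := strict_chain_le layer_start_lt.
have layerP C : alpha C -> C x ->
    exists j U, [/\ (j <= k <= j.+1)%N, beta j U, U x &
      C = U `&` (w (t j) `\` closure (w (t j.+2)))].
  move=> [j [D bD ->]] [Dx [/w_s js /ncl_s sj]]; exists j, D; split => //.
  apply/andP; split; rewrite leqNgt; apply/negP => /tle H.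
    by move: sk; rewrite ltnNge (leq_trans H js).
  by move: sj; rewrite ltnNge (leq_trans H ks).
case: k => [|[|h]] in ks sk layerP *.
(* The first layer is the single set [B]; it adds one to the order of [V 0]. *)
- exists [:: B] => // C aC Cx.
  have [j [D [/andP[+ _] bD _ ->]]] := layerP _ aC Cx.
  by rewrite leqn0 => /eqP j0; move: bD; rewrite j0 => ->; exact: mem_head.
- exists (B :: map (A 0%N) (S 0%N)); first by rewrite /= size_map ltnS.
  move=> C aC Cx.
  have [j [D [/andP[jk _] bD Dx ->]]] := layerP _ aC Cx.
  have /orP[/eqP ej|/eqP ej] : (j == 0%N) || (j == 1%N) by lia.
    by move: bD; rewrite ej => ->; exact: mem_head.
  move: bD Dx; rewrite ej => -[v _ <-] [[Vx _] _]; rewrite inE.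
  by apply/orP; right; exact/map_f/inS.
(* Just below the start of layer [h.+2], the sets of the previous layer are not
   yet shrunk and the new ones not yet switched on. *)
have [ncl|/contrapT cl] := pselect (~ closure (w (t h.+2).+1) x).
  exists (map (A h) (S h)); first by rewrite size_map leqW.
  move=> C aC Cx; have [j [D [/andP[jk kj] bD Dx ->]]] := layerP _ aC Cx.
  have /orP[/eqP ej|/eqP ej] : (j == h.+1) || (j == h.+2) by lia.
    move: bD Dx; rewrite ej => -[v _ <-] [[Vx _] _]; exact/map_f/inS.
  move: bD Dx; rewrite ej => -[v _ <-] [[_ /w_s ls] _].
  have := ncl_s _ ncl; have := switch_gt h.+1 v; lia.
exists (map (fun u => A h (p h u)) [seq u <- S h.+1 | (s <= l h.+1 u)%N] ++
        map (A h.+1) [seq v <- S h.+1 | (l h.+1 v <= s)%N]).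
  rewrite size_cat !size_map !size_filter -count_predUI.
  rewrite -(addn1 N); apply: leq_add; first exact: leq_trans (count_size _ _) _.
  apply: (@leq_trans (count_mem (s - (t h.+2).+1)%N (S h.+1))).
    apply: sub_count => v /andP[sl ls]; apply/eqP.
    have -> : s = ((t h.+2).+1 + v)%N.
      by apply/eqP; rewrite eqn_leq addSn; apply/andP.
    by rewrite addKn.
  by rewrite count_uniq_mem// leq_b1.
move=> C aC Cx; have [j [D [/andP[jk kj] bD Dx ->]]] := layerP _ aC Cx.
rewrite mem_cat; apply/orP.
have /orP[/eqP ej|/eqP ej] : (j == h.+1) || (j == h.+2) by lia.
  left; move: bD Dx; rewrite ej => -[v _ <-] [_ [[//|]|]].
    move=> [u /= pu [Vu /ncl_s su]]; rewrite -pu; apply/mapP; exists u => //.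
    by rewrite mem_filter inS// andbT.
  by move=> /w_s; rewrite leqNgt sk.
right; move: bD Dx; rewrite ej => -[v _ <-] [[Vx /w_s ls] _].
by apply/mapP; exists v => //; rewrite mem_filter inS// ls.
Qed.
End staircase.

(** * Choosing the depths *)

Lemma closed_neighbourhood_sequence (R : realType) (T : metricType R)
    (X : set T) : closed X ->
  exists W : nat -> set T, [/\ forall n, open (W n), W 0%N = setT,
    forall n, closure (W n.+1) `<=` W n & \bigcap_n W n = X].
Proof.
move=> clX; pose N (r : R) := [set x | exists2 y, X y & mdist y x < r].
have oN r : open (N r).
  rewrite openE => x [y Xy yx]; rewrite /interior.
  have d0 : 0 < r - mdist y x by rewrite subr_gt0.
  apply: filterS (nbhsx_ballx x _ d0) => z; rewrite ballEmdist/= => xz.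
  exists y => //; rewrite (le_lt_trans (metric_triangle _ x _))//.
  by rewrite -ltrBrDl.
exists (fun n => if n is k.+1 then N k.+1%:R^-1 else setT); split => //.
- by case=> // ; exact: openT.
- case=> [|k] x //= cx.
  have d0 : 0 < k.+1%:R^-1 - k.+2%:R^-1 :> R.
    by rewrite subr_gt0 ltf_pV2 ?posrE// ltr_nat.
  have [z [[y Xy yz]]] := cx _ (nbhsx_ballx x _ d0).
  rewrite ballEmdist/= metric_sym => zx; exists y => //.
  rewrite (le_lt_trans (metric_triangle _ z _))//.
  by rewrite -(subrK k.+2%:R^-1 k.+1%:R^-1) addrC ltrD.
- apply/seteqP; split => [x xN|x Xx [|k] _ //=]; last first.
    by exists x => //; rewrite mdistxx invr_gt0.
  rewrite (closure_id X).1//= => B /nbhs_ballP[e /= e0 eB].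
  have [k] := ltr_add_invr e0; rewrite add0r => ke.
  have [y Xy yx] := xN k.+1 I; exists y; split => //; apply: eB.
  by rewrite ballEmdist/= metric_sym (lt_trans yx).
Qed.

(** Both requirements on the depths are instances of [uniform_cover_lebesgue]:
    for the family whose only member is the previous depth, and for [V k]. *)
Lemma adapted_subsequence (R : realType) (T : metricType R) (X : set T)
    (gamma : set (set T)) (W : nat -> set T) (V : nat -> nat -> set T) :
  compact [set: T] -> uniform_cover X gamma -> (forall n, open (W n)) ->
  (forall n, closure (W n.+1) `<=` W n) -> \bigcap_n W n = X ->
  (forall k v, open (V k v)) -> (forall k, X `<=` \bigcup_v V k v) ->
  exists n : nat -> nat, [/\ n 0%N = 0%N, forall s, (n s < n s.+1)%N,
    forall s G, gamma G -> G `&` closure (W (n s.+1)) !=set0 -> G `<=` W (n s) &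
    forall k s G, (k < s)%N -> gamma G -> G !=set0 -> G `<=` W (n s) ->
      exists v, G `<=` V k v].
Proof.
move=> cT ug oW Wcl WX oV VX.
have /choice[M MP] : forall a, exists n0, forall G, gamma G ->
    G `&` W n0 !=set0 -> G `<=` W a.
  move=> a.
  have [||n0 H] := uniform_cover_lebesgue (O := fun=> W a) cT ug Wcl WX.
  - by [].
  - by rewrite -WX => x Wx; exists 0%N => //; exact: Wx.
  by exists n0 => G gG /(H _ (leqnn _) _ gG)[].
have /choice[L LP] : forall k, exists n0, forall n, (n0 <= n)%N ->
    forall G, gamma G -> G `&` W n !=set0 -> exists v, G `<=` V k v.
  by move=> k; exact: uniform_cover_lebesgue cT ug Wcl WX (oV k) (VX k).
pose n := fix n s := if s is r.+1 then (maxn (n r) (maxn (M (n r)) (L r))).+1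
  else 0%N.
have nlt s : (n s < n s.+1)%N by rewrite /= ltnS leq_maxl.
exists n; split => // [s G gG [x [Gx cx]]|k s G ks gG [x Gx] Gs].
  apply: MP gG _; exists x; split => //; apply: (Wcl _).
  apply: (closureS (closure_chain_decreasing Wcl _)) cx.
  by rewrite /= ltnS !leq_max leqnn !orbT.
apply: (LP k (n s) _ G gG); last by exists x; split => //; exact: Gs.
apply: leq_trans (strict_chain_le nlt ks); rewrite /=.
by rewrite leqW// !leq_max leqnn !orbT.
Qed.

Theorem proposition49 (R : realType) (T : metricType R) (X : set T)
    (packX : compactification_pack X)
    (gamma : set (set T)) (ugamma : uniform_cover X gamma) :
  (exists alpha : set (set T),
    [/\ open_locally_finite_cover X alpha, uniform_cover X alpha,
        canonical_cover X alpha, refines gamma alpha &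
        (mult R alpha <= covering_dim R (set_type X) + 2%:E)%E])
  /\
  (forall W : nat -> set T,
    (forall n, open (W n)) ->
    W 0%N = setT ->
    (forall n, closure (W n.+1) `<=` W n) ->
    \bigcap_n W n = X ->
    exists (beta : nat -> set (set T)) (i : nat -> nat),
      let alpha := layered_family W beta i in
      [/\ [/\ forall k, finite_set (beta k),
              forall k, beta k `<=` open,
              beta 0%N = [set setT],
              forall k, X `<=` \bigcup_(V in beta k) V &
              (fun p : nat * nat =>
                 mesh [set V `&` W p.2 | V in beta p.1])
                @ filter_prod \oo \oo --> 0%E],
          (forall k, (i k < i k.+1)%N) /\ i 0%N = 0%N &
          [/\ open_locally_finite_cover X alpha, uniform_cover X alpha,
              canonical_cover X alpha, refines gamma alpha &
              (mult R alpha <= covering_dim R (set_type X) + 2%:E)%E]]).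
Proof.
have [cT clX _] := packX; set layered := (X in _ /\ X).
suff main : layered.
  split=> //; have [W [oW W0 Wcl WX]] := closed_neighbourhood_sequence clX.
  have [beta [i [_ _ H]]] := main W oW W0 Wcl WX.
  by exists (layered_family W beta i).
rewrite /layered => {layered} W oW W0 Wcl WX.
have cX : compact X by apply: subclosed_compact clX cT _.
have [V [m [Vo VX Vref Vsmall VN]]] := fine_cover_sequence cX.
have Vm k v x : V k v x -> (v < m k)%N.
  by rewrite ltnNge => Vx; apply/negP => /((Vo k v).2) V0; rewrite V0 in Vx.
have Vop k v : open (V k v) by have [] := Vo k v.
have /choice[p pP] : forall k, exists pk : nat -> nat, forall u,
    V k.+1 u `<=` V k (pk u).
  by move=> k; have /choice[q qV] := Vref k; exists q.
have [n [n0 nlt nG nV]] := adapted_subsequence cT ugamma oW Wcl WX Vop VX.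
pose w s := W (n s).
have w0 : w 0%N = setT by rewrite /w n0.
have wcl s : closure (w s.+1) `<=` w s.
  move=> x cx; apply: (Wcl _).
  exact: (closureS (closure_chain_decreasing Wcl (nlt s))) cx.
have wX : \bigcap_s w s = X.
  rewrite -WX; apply/seteqP; split => x H k _; last exact: H.
  apply: (closure_chain_decreasing Wcl (strict_chain_ge nlt k)); exact: H.
pose t := layer_start m; pose beta := staircase_family w V m p.
have tlt := @layer_start_lt m.
have ilt k : (n (t k) < n (t k.+1))%N.
  by apply: leq_trans (nlt _) _; apply: (strict_chain_le nlt); exact: tlt.
have [gcov [gX _]] := ugamma.
have bfin k : finite_set (beta k) by exact: staircase_finite.
have bo k : beta k `<=` open by apply: staircase_open => // s; exact: oW.
have bsmall k A x y : beta k.+1 A -> A x -> A y -> mdist x y <= k.+2%:R^-1.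
  by move=> [v _ <-] [[Vx _] _] [[Vy _] _]; exact: Vsmall Vx Vy.
have ref : refines gamma (layered_family W beta (n \o t)).
  apply: (staircase_refine w0 wcl wX Vm pP).
  - by move=> G gG x Gx; have [] := gX (x, x) (ex_intro2 _ _ G gG (conj Gx Gx)).
  - exact: nG.
  - move=> k G gG Gn Gw; apply: (nV k _ _ _ gG Gn Gw).
    exact: (strict_chain_ge tlt).
have acov : ~` X `<=` \bigcup_(A in layered_family W beta (n \o t)) A.
  by rewrite -gcov => x [G /ref[A aA GA] /GA Ax]; exists A.
have small (e : R) : 0 < e -> exists K, forall k U x y,
    (K <= k)%N -> beta k U -> U x -> U y -> mdist x y < e.
  move=> e0; have [K] := ltr_add_invr e0; rewrite add0r => Ke.
  exists K.+1 => -[//|k] U x y Kk bU Ux Uy.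
  rewrite (le_lt_trans (bsmall _ _ _ _ bU Ux Uy))// (le_lt_trans _ Ke)//.
  by rewrite lef_pV2 ?posrE// ler_nat ltnW.
exists beta, (n \o t); split.
- split => //; first by move=> k; exact: staircase_covers.
  have h0 : (fun q : nat * nat => (q.1.+1%:R^-1)%:E : \bar R)
      @ filter_prod \oo \oo --> 0%E.
    apply/cvg_EFin; first by near=> q.
    exact: cvg_comp cvg_fst cvg_harmonic.
  apply: squeeze_cvge _ (cvg_cst 0%E) h0.
  exists ([set k | (0 < k)%N], setT).
    by split; [exact: nbhs_infty_gt|exact: filterT].
  move=> [[|k] j] [/= + _] => // _; rewrite sup_nneg_ge0/=.
  apply: mesh_le => // _ x y [U bU <-] [Ux _] [Uy _].
  exact: (bsmall _ _ _ _ bU Ux Uy).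
- by split => //=; rewrite n0.
- have can := layered_canonical oW Wcl WX bfin bo ilt acov small.
  split => //; first by case: can.
    exact: (layered_uniform cT oW Wcl WX bfin bo ilt acov small).
  apply: mult_le_dim => N XN; apply: (staircase_mult p w0 wcl Vm) => k.
  exact: VN.
Unshelve. all: by end_near. Qed.
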